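(* Let $W$ be a neat, upward-restricted layered wheel. Then there is a constant $c$ (depending on $W$) such that every $n$-vertex induced subgraph of $W$ with $n\ge 2$ has treewidth at most $c\log n$; that is, the $n$-vertex induced subgraphs of $W$ have treewidth $O(\log n)$.
   Context: A layered wheel is a countably infinite graph $W$ on the same vertex set as a countably infinite, locally finite rooted tree $T$ embedded in the plane, such that: (1) for every natural number $n$, the set $L_n$ of nodes at distance $n$ from the root of $T$ induces in $W$ a finite path visiting the nodes of $L_n$ in the left-to-right order of the planar embedding of $T$; the edges with both endpoints in a common layer $L_n$ are the layer edges, forming the set $E_L$; (2) every edge of $W$ not in $E_L$ joins a pair of nodes in ancestor–descendant relation in $T$; (3) there is a finite bound on the length of paths in $T$ consisting only of nodes of degree $2$ in $T$. A node is its own ancestor and descendant. $W$ is neat if $T$ has no leaf. $W$ is upward-restricted if there is an integer $t$ such that for every node $v$ of $T$ there is a set $X_v$ of at most $t$ ancestors of $v$ such that in $W-E_L$ every edge with exactly one endpoint among the descendants of $v$ has its other endpoint in $X_v$. *)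

(* Defs.v *)
From Stdlib Require Import Reals.
From mathcomp Require Import all_boot.

Set Implicit Arguments.
Unset Strict Implicit.
Unset Printing Implicit Defensive.

(* A plane rooted tree is given by its root r and, for every node v,   *)
(* the ordered (left-to-right) list of its children ch v.  Lists are   *)
(* finite, so the tree is locally finite.                              *)

Fixpoint layer (r : nat) (ch : nat -> seq nat) (n : nat) : seq nat :=
  match n with
  | 0 => [:: r]
  | n'.+1 => flatten (map ch (layer r ch n'))
  end.

Definition is_rooted_tree (r : nat) (ch : nat -> seq nat) : Prop :=
  [/\ forall v, uniq (ch v),
      forall v, r \notin ch v,
      forall v, v <> r -> exists u, v \in ch u,
      forall u u' v, v \in ch u -> v \in ch u' -> u = u'
    & forall v, exists n, v \in layer r ch n].

Inductive anc (ch : nat -> seq nat) (u : nat) : nat -> Prop :=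
  | anc_refl : anc ch u u
  | anc_step : forall w v, anc ch u w -> v \in ch w -> anc ch u v.

Definition tadj (ch : nat -> seq nat) (u v : nat) : Prop :=
  v \in ch u \/ u \in ch v.

Definition tdeg (r : nat) (ch : nat -> seq nat) (v : nat) : nat :=
  size (ch v) + (v != r).

Fixpoint chainP (R : nat -> nat -> Prop) (x : nat) (s : seq nat) : Prop :=
  match s with
  | [::] => True
  | y :: s' => R x y /\ chainP R y s'
  end.

Definition same_layer (r : nat) (ch : nat -> seq nat) (x y : nat) : Prop :=
  exists n, x \in layer r ch n /\ y \in layer r ch n.

Definition consecutive (s : seq nat) (x y : nat) : Prop :=
  exists i, i.+1 < size s /\
    ((nth 0 s i = x /\ nth 0 s i.+1 = y) \/ (nth 0 s i = y /\ nth 0 s i.+1 = x)).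

Definition layered_wheel (r : nat) (ch : nat -> seq nat)
    (E : nat -> nat -> Prop) : Prop :=
  [/\ is_rooted_tree r ch,
      (forall x y, E x y -> E y x) /\ (forall x, ~ E x x),
      (forall n x y, x \in layer r ch n -> y \in layer r ch n ->
          (E x y <-> consecutive (layer r ch n) x y)),
      (forall x y, E x y -> ~ same_layer r ch x y -> anc ch x y \/ anc ch y x)
    &
      (exists B, forall x s, uniq (x :: s) -> chainP (tadj ch) x s ->
          all (fun v => tdeg r ch v == 2) (x :: s) -> size s <= B)].

Definition neat (ch : nat -> seq nat) : Prop := forall v, 0 < size (ch v).

Definition upward_restricted (r : nat) (ch : nat -> seq nat)
    (E : nat -> nat -> Prop) : Prop :=
  exists t : nat, forall v : nat, exists X : seq nat,
    [/\ size X <= t,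
        (forall u, u \in X -> anc ch u v)
      & (forall x y, E x y -> ~ same_layer r ch x y ->
           anc ch v x -> ~ anc ch v y -> y \in X)].

Definition is_finite_tree (I : finType) (e : rel I) : Prop :=
  [/\ 0 < #|I|, symmetric e, irreflexive e,
      (forall i j, connect e i j)
    & (forall s : seq I, uniq s -> 2 < size s -> ~~ cycle e s)].

Definition tree_decomposition_le (E : nat -> nat -> Prop) (S : seq nat)
    (k : nat) : Prop :=
  exists (I : finType) (e : rel I) (B : I -> seq nat),
  [/\ is_finite_tree e /\ (forall i, {subset B i <= S}),
      (forall x, x \in S -> exists i, x \in B i),
      (forall x y, x \in S -> y \in S -> E x y ->
         exists i, x \in B i /\ y \in B i),
      (forall x i j, x \in B i -> x \in B j ->
         connect [rel a b | [&& e a b, x \in B a & x \in B b]] i j)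
    & (forall i, size (undup (B i)) <= k.+1)].

Definition treewidth_le (E : nat -> nat -> Prop) (S : seq nat) (k : nat) : Prop :=
  tree_decomposition_le E S k.

(* Main.v *)
(** For a finite vertex set [S], continue every node [v] downwards by a spine,
    always moving to the child with the fewest descendants in [S].  Every
    branching node on the spine halves that number, and branching nodes occur
    at bounded distance, so a spine meets [S] in O(log |S|) vertices.  The spine
    of [v], together with the at most [t] ancestors of [v] that have a neighbour
    below [v], is called the boundary of [v]; the boundaries of two consecutive
    nodes of a layer separate the part of the wheel lying below and between them
    from the rest.  These gaps are nested from one layer to the next, and
    attaching the bag of each gap (its own boundaries and those of the gap
    above it) to the bag of the gap on its left below the same upper gap, or
    to that upper gap when there is none, gives a tree decomposition. *)
Require Import Defs.
From Stdlib Require Import Reals ClassicalEpsilon Lra.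
From mathcomp Require Import all_boot.
From mathcomp Require Import zify.

Set Implicit Arguments.
Unset Strict Implicit.
Unset Printing Implicit Defensive.

(** * Decidability by excluded middle, and duplicate-free lists *)

Definition holds (P : Prop) : bool :=
  if excluded_middle_informative P then true else false.

Lemma holdsP (P : Prop) : reflect P (holds P).
Proof.
by rewrite /holds; case: excluded_middle_informative => H; constructor.
Qed.

Lemma uniq_map_inj (T U : eqType) (f : T -> U) (s : seq T) x y :
  uniq (map f s) -> x \in s -> y \in s -> f x = f y -> x = y.
Proof.
elim: s => //= a s IH /andP[nin us]; rewrite !inE.
case/orP=> [/eqP->|xs]; case/orP=> [/eqP->|ys] // E; last exact: IH.
- by case/negP: nin; rewrite E map_f.
- by case/negP: nin; rewrite -E map_f.
Qed.

Lemma uniq_flatten_map (T U : eqType) (f : T -> seq U) (s : seq T) :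
  uniq s -> (forall a, a \in s -> uniq (f a)) ->
  (forall a b x, a \in s -> b \in s -> x \in f a -> x \in f b -> a = b) ->
  uniq (flatten (map f s)).
Proof.
elim: s => //= a s IH /andP[nin us] uf inj.
rewrite cat_uniq uf ?mem_head //= IH //.
- rewrite andbT; apply/hasPn => x /flatten_mapP[b bs xb]; apply/negP => xa.
  by case/negP: nin; rewrite (inj a b x) ?inE ?eqxx ?bs ?orbT.
- by move=> b bs; rewrite uf // inE bs orbT.
- by move=> b c x bs cs; apply: inj; rewrite inE ?bs ?cs orbT.
Qed.

(** * Tree decompositions from attached bags *)

Section ParentTree.
Variables (m : nat) (p : nat -> nat).
Hypothesis p_lt : forall i, 0 < i -> i < m.+1 -> p i < i.

(** Index 0 is the root; the guards discard the value of [p] there, about which nothing is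
    assumed. *)
Definition parent_rel : rel 'I_m.+1 :=
  fun i j => (0 < j) && (p j == i) || (0 < i) && (p i == j).

Lemma parent_relC : symmetric parent_rel.
Proof. by move=> i j; rewrite /parent_rel orbC. Qed.

Lemma parent_rel_step (i : 'I_m.+1) :
  0 < i -> exists2 j : 'I_m.+1, j = p i :> nat & parent_rel i j.
Proof.
move=> i0; have pm : p i < m.+1 by apply: ltn_trans (ltn_ord i); apply: p_lt.
by exists (Ordinal pm); rewrite // /parent_rel i0 eqxx orbT.
Qed.

Lemma parent_rel_finite_tree : is_finite_tree parent_rel.
Proof.
split.
- by rewrite card_ord.
- exact: parent_relC.
- move=> i; rewrite /parent_rel orbb; apply/negbTE/negP => /andP[i0 /eqP E].
  by have := p_lt i0 (ltn_ord i); rewrite E ltnn.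
- have to0 n (i : 'I_m.+1) : i <= n -> connect parent_rel i ord0.
    elim: n i => [|n IH] i le_in.
      suff -> : i = ord0 by [].
      by apply/val_inj => /=; apply/eqP; rewrite -leqn0.
    case: (posnP i) => [i0|i0].
      by have -> : i = ord0 by apply/val_inj.
    have [j Ej eij] := parent_rel_step i0.
    apply: connect_trans (connect1 eij) (IH _ _).
    by rewrite -ltnS (leq_trans _ le_in) // Ej p_lt.
  move=> i j; apply: connect_trans (to0 _ i (leqnn _)) _.
  by rewrite (sym_connect_sym parent_relC) (to0 _ j (leqnn _)).
- move=> s us s2; apply/negP => cs.
  have [x0 x0s] : exists x, x \in s.
    by case: (s) s2 => // x t _; exists x; rewrite mem_head.
  (* Both cyclic neighbours of the largest vertex of a cycle would have to be its parent. *)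
  case: (arg_maxnP (fun i : 'I_m.+1 => val i) x0s) => M Ms Mmax.
  have [k t Et] := rot_to Ms.
  have mem_t i : i \in t -> i \in s by move=> it; rewrite -(mem_rot k) Et inE it orbT.
  have par i : i \in t -> parent_rel M i -> val i = p M.
    move=> it /orP[/andP[i0 /eqP E]|/andP[_ /eqP->//]].
    have := p_lt i0 (ltn_ord i); rewrite E ltnNge => /negP[].
    exact: Mmax (mem_t i it).
  move: us cs s2; rewrite -(rot_uniq k) -(rot_cycle k) -(size_rot k) Et.
  case/lastP: t Et mem_t par => [|t b] // Et mem_t par.
  case: t Et mem_t par => [|a t] // Et mem_t par.
  rewrite rcons_cons cons_uniq => /andP[_ ut].
  rewrite /= rcons_path last_rcons => /andP[Ma /andP[_ bM]] _.
  move: ut; rewrite /= mem_rcons inE => /andP[/norP[/eqP[]]].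
  apply: val_inj; rewrite (par a) ?inE ?eqxx //; rewrite (par b) //.
    by rewrite inE mem_rcons inE eqxx orbT.
  by rewrite parent_relC.
Qed.

End ParentTree.

Section Attached.
Variables (T : eqType) (key : T -> nat) (bag : T -> seq nat).
Variable own : nat -> nat -> Prop.

(* Every bag only adds to the bag it is attached to vertices owned by its key;
   when keys are distinct, every vertex enters the decomposition only once. *)
Inductive attached : seq T -> Prop :=
| attached1 s : (forall x, x \in bag s -> own x (key s)) -> attached [:: s]
| attached_rcons l s s0 : attached l -> s0 \in l ->
    (forall x, x \in bag s -> x \in bag s0 \/ own x (key s)) ->
    attached (rcons l s).

(** The parent of a bag is the position of the bag it was attached to, which comes earlier in the
    list. *)
Lemma attached_parent (d : T) l : attached l ->
  exists p : nat -> nat, forall i, i < size l ->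
    (forall x, x \in bag (nth d l i) -> own x (key (nth d l i)) \/
       0 < i /\ x \in bag (nth d l (p i))) /\ (0 < i -> p i < i).
Proof.
elim=> [s H|{}l s s0 _ [p Hp] s0l H].
  by exists id => -[|i] //= _; split=> // x xs; left; apply: H.
exists (fun i => if i == size l then index s0 l else p i) => i.
have idx : index s0 l < size l by rewrite index_mem.
rewrite size_rcons ltnS leq_eqVlt; case: eqP => [-> _|_ /= lt_il].
  split=> [x|_ //]; rewrite !nth_rcons ltnn eqxx idx nth_index //.
  by case/H; [right; split=> //; apply: leq_trans idx | left].
have [H1 H2] := Hp i lt_il; split=> // x; rewrite nth_rcons lt_il => /H1.
case=> [o|[i0 xp]]; [by left | right; split=> //].
by rewrite nth_rcons (ltn_trans (H2 i0) lt_il).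
Qed.

Hypothesis own_inj : forall x a b, own x a -> own x b -> a = b.

(** Climbing from any bag that contains [x] leads through bags containing [x] to one whose key owns
    [x]. By [own_inj] and the distinctness of keys there is only one such bag, so the bags
    containing [x] are connected through it. *)
Lemma attached_decomposition (E : nat -> nat -> Prop) (S : seq nat) l k :
  attached l -> uniq (map key l) ->
  (forall s, s \in l -> {subset bag s <= S}) ->
  (forall x, x \in S -> exists2 s, s \in l & x \in bag s) ->
  (forall x y, x \in S -> y \in S -> E x y ->
     exists s, [/\ s \in l, x \in bag s & y \in bag s]) ->
  (forall s, s \in l -> size (bag s) <= k.+1) ->
  treewidth_le E S k.
Proof.
move=> att ul subS covV covE szb.
have [d] : exists d, d \in l.
  by case: att => [s|l' s *]; exists s; rewrite ?mem_head // mem_rcons mem_head.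
case: (posnP (size l)) => [/size0nil->//|lpos] _.
have [p Hp] := attached_parent d att.
have [m Em] : exists m, size l = m.+1 by case: (size l) lpos => // m; exists m.
have p_lt i : 0 < i -> i < m.+1 -> p i < i.
  by move=> i0 im; rewrite -Em in im; have [_] := Hp i im; apply.
pose B (i : 'I_m.+1) := bag (nth d l i).
have Bmem (i : 'I_m.+1) : nth d l i \in l by rewrite mem_nth // Em.
have posn s : s \in l -> exists i : 'I_m.+1, nth d l i = s.
  move=> sl; have lt : index s l < m.+1 by rewrite -Em index_mem.
  by exists (Ordinal lt); rewrite nth_index.
exists 'I_m.+1, (parent_rel p), B; split.
- split; first exact: parent_rel_finite_tree.
  by move=> i; apply: subS.
- by move=> x /covV[s /posn[i <-] xs]; exists i.
- move=> x y xS yS /(covE _ _ xS yS)[s [/posn[i <-] xs ys]].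
  by exists i.
- move=> x.
  set R := [rel _ _ | _].
  have Rsym : symmetric R.
    by move=> a b; rewrite /R /= parent_relC (andbC (x \in B a)).
  have Csym := sym_connect_sym Rsym.
  (* Induction on [i + j]: unless both keys own [x], and then the bags coincide, one of the two
     indices can be replaced by its smaller parent. *)
  have main n (i j : 'I_m.+1) : i + j <= n -> x \in B i -> x \in B j ->
      connect R i j.
    elim: n i j => [|n IH] i j le_n xi xj.
      have -> // : i = j.
      by apply/val_inj => /=; lia.
    have step (a b : 'I_m.+1) : a + b <= n.+1 -> x \in B a -> x \in B b ->
        0 < a -> x \in bag (nth d l (p a)) -> connect R a b.
      move=> le_ab xa xb a0 xp; have [c Ec eac] := parent_rel_step p_lt a0.
      have xc : x \in B c by rewrite /B Ec.
      have Rac : R a c by rewrite /R /= eac xa xc.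
      have Rac' : connect R a c by apply: connect1.
      apply: (connect_trans Rac'); apply: IH => //.
      by rewrite -ltnS (leq_trans _ le_ab) // ltn_add2r Ec p_lt.
    have [Hi _] := Hp i ltac:(by rewrite Em).
    have [Hj _] := Hp j ltac:(by rewrite Em).
    case: (Hi x xi) => [oi|[i0 xp]]; last exact: step.
    case: (Hj x xj) => [oj|[j0 xp]].
      have Ek := own_inj oi oj.
      have En := uniq_map_inj ul (Bmem i) (Bmem j) Ek.
      have -> // : i = j.
      apply/val_inj/eqP; rewrite -(nth_uniq d _ _ (map_uniq ul)) ?Em ?ltn_ord //.
      exact/eqP.
    by rewrite Csym; apply: step => //; rewrite addnC.
  by move=> i j; apply: main (leqnn _).
- by move=> i; rewrite (leq_trans (size_undup _)) // szb.
Qed.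

End Attached.

(** * Layers and spines *)

Definition adjacent_pairs (s : seq nat) := zip s (behead s).

Lemma mem_adjacent_pairs x y s : infix [:: x; y] s -> (x, y) \in adjacent_pairs s.
Proof.
rewrite /adjacent_pairs; elim: s => [|a [|b s] IH] //=; first by rewrite andbF.
rewrite prefix0s andbT => /orP[/andP[/eqP<- /eqP<-]|H]; first by rewrite mem_head.
by rewrite inE IH ?orbT.
Qed.

Lemma unzip1_adjacent s x : unzip1 (adjacent_pairs (rcons s x)) = s.
Proof.
rewrite /adjacent_pairs; elim: s => [|a s] //=.
by case: s => [|b s] //= ->.
Qed.

Lemma unzip2_adjacent s : unzip2 (adjacent_pairs s) = behead s.
Proof. by rewrite unzip2_zip // size_behead leq_pred. Qed.

Lemma infix2_cat (x y : nat) a b : infix [:: x; y] (a ++ b) ->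
  [\/ infix [:: x; y] a, infix [:: x; y] b
    | exists s t, a = rcons s x /\ b = y :: t].
Proof.
elim: a => [|c a IH] /=; first by constructor 2.
case/orP=> [/andP[/eqP<-]|/IH[H|H|[s [t [-> ->]]]]].
- case: a {IH} => [|d a] /=.
    case: b => [|d b] //=; rewrite prefix0s andbT => /eqP<-.
    by constructor 3; exists [::], b.
  by rewrite !prefix0s => /andP[-> _]; constructor 1; rewrite eqxx.
- by constructor 1; rewrite H orbT.
- by constructor 2.
- by constructor 3; exists (c :: s), t.
Qed.

(** Since no block is empty, neighbours from different blocks come from consecutive ones. *)
Lemma infix2_flatten (f : nat -> seq nat) s x y : (forall v, f v != [::]) ->
  infix [:: x; y] (flatten (map f s)) ->
  (exists2 u, u \in s & infix [:: x; y] (f u)) \/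
  exists u v a b, [/\ infix [:: u; v] s, f u = rcons a x & f v = y :: b].
Proof.
move=> fne; elim: s => //= u s IH /infix2_cat[H|/IH[[v vs H]|]|].
- by left; exists u; rewrite ?mem_head.
- by left; exists v; rewrite // inE vs orbT.
- by move=> [v [w [a [b [vw Ev Ew]]]]]; right; exists v, w, a, b; split=> //; rewrite vw orbT.
- move=> [a [b [Ea]]]; case: s {IH} => [|v s] //=; move: (fne v).
  case Ev: (f v) => [|c l] //= _ [Ec _]; right; exists u, v, a, l.
  by rewrite Ea Ev Ec prefix0s !eqxx.
Qed.

Lemma consecutive_infix s x y : consecutive s x y ->
  infix [:: x; y] s \/ infix [:: y; x] s.
Proof.
have aux i a b : i.+1 < size s -> nth 0 s i = a -> nth 0 s i.+1 = b ->
    infix [:: a; b] s.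
  move=> lt <- <-; apply/infixP; exists (take i s), (drop i.+2 s) => /=.
  by rewrite -drop_nth // -drop_nth ?cat_take_drop // ltnW.
by case=> i [lt [[Ea Eb]|[Eb Ea]]]; [left|right]; apply: aux lt _ _.
Qed.

Section RootedTree.
Variables (r : nat) (ch : nat -> seq nat).
Hypothesis tree : is_rooted_tree r ch.
Notation layer := (layer r ch).
Notation anc := (anc ch).

Lemma uniq_children v : uniq (ch v). Proof. by case: tree. Qed.

Lemma parent_inj u u' v : v \in ch u -> v \in ch u' -> u = u'.
Proof. by case: tree => _ _ _ + _; apply. Qed.

Lemma root_not_child v : r \notin ch v. Proof. by case: tree. Qed.

Lemma mem_layerS n v :
  v \in layer n.+1 <-> exists2 u, u \in layer n & v \in ch u.
Proof. by split=> [/flatten_mapP|?]; last apply/flatten_mapP. Qed.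

Lemma layer_inj n m v : v \in layer n -> v \in layer m -> n = m.
Proof.
elim: n m v => [|n IH] [|m] v //.
- rewrite inE => /eqP -> /mem_layerS[u _ /idPn[]]; exact: root_not_child.
- move=> /mem_layerS[u _ vu]; rewrite inE => /eqP E.
  by case/idPn: vu; rewrite E root_not_child.
- move=> /mem_layerS[u un vu] /mem_layerS[w wm vw].
  by congr _.+1; apply: IH un _; rewrite (parent_inj vu vw).
Qed.

Lemma anc_trans u v w : anc u v -> anc v w -> anc u w.
Proof. by move=> uv; elim=> // x y _ ux yx; apply: anc_step ux yx. Qed.

Lemma anc_child u v : v \in ch u -> anc u v.
Proof. by apply: anc_step; apply: anc_refl. Qed.

Lemma anc_parent u v w : anc u v -> v \in ch w -> u = v \/ anc u w.
Proof.
case=> [|x y ux yx] yw; first by left.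
by right; rewrite -(parent_inj yx yw).
Qed.

Lemma anc_layer u v n :
  anc u v -> u \in layer n -> u = v \/ exists2 m, n < m & v \in layer m.
Proof.
move=> uv un; elim: uv => [|x y _ IH yx]; first by left.
right; case: IH => [E|[m nm xm]].
  by exists n.+1 => //; apply/mem_layerS; exists u; rewrite ?E // -E in yx *.
by exists m.+1; [apply: leqW | apply/mem_layerS; exists x].
Qed.

Lemma anc_layer_leq u v n m : anc u v -> u \in layer n -> v \in layer m -> n <= m.
Proof.
move=> uv un vm; case: (anc_layer uv un) => [E|[k nk vk]].
  by rewrite (@layer_inj n m v) // -E.
by rewrite (layer_inj vm vk) ltnW.
Qed.

Lemma anc_layer_eq u v n : anc u v -> u \in layer n -> v \in layer n -> u = v.
Proof.
move=> uv un vn; case: (anc_layer uv un) => // -[m nm vm].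
by rewrite (layer_inj vn vm) ltnn in nm.
Qed.

Lemma anc_disjoint u v x n :
  u \in layer n -> v \in layer n -> anc u x -> anc v x -> u = v.
Proof.
move=> un vn ux; elim: ux => [|w y uw IH yw] vx.
  by rewrite (anc_layer_eq vx vn un).
case: (anc_parent vx yw) => [E|]; last exact: IH.
by apply: (anc_layer_eq (n := n)) => //; rewrite E; apply: anc_step uw yw.
Qed.

Lemma in_layer v : exists n, v \in layer n. Proof. by case: tree. Qed.

Lemma child_layer u v n : v \in ch u -> u \in layer n -> v \in layer n.+1.
Proof. by move=> vu un; apply/mem_layerS; exists u. Qed.

Lemma siblings_disjoint u v w x :
  u \in ch w -> v \in ch w -> anc u x -> anc v x -> u = v.
Proof.
have [n wn] := in_layer w; move=> uw vw.
exact: (anc_disjoint (child_layer uw wn) (child_layer vw wn)).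
Qed.

Lemma anc_antisym u v : anc u v -> anc v u -> u = v.
Proof.
have [n un] := in_layer u; have [m vm] := in_layer v => uv vu.
apply: (anc_layer_eq uv un); rewrite (_ : n = m) //; apply/eqP.
by rewrite eqn_leq (anc_layer_leq uv un vm) (anc_layer_leq vu vm un).
Qed.

(** * Spines of lightest children *)

Section Descent.
Hypothesis no_leaf : neat ch.
Variable S : seq nat.

Definition weight v := count (fun x => holds (anc v x)) S.

(** The default 0 is never reached, as [no_leaf] gives every node a child. *)
Definition lightest v := head 0 (sort (relpre weight leq) (ch v)).

Lemma lightestP v : lightest v \in ch v /\
  forall c, c \in ch v -> weight (lightest v) <= weight c.
Proof.
rewrite /lightest; have := no_leaf v.
have tot : total (relpre weight leq) by move=> a b; apply: leq_total.
have tr : transitive (relpre weight leq) by move=> a b c; apply: leq_trans.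
rewrite -(size_sort (relpre weight leq)).
have := sort_sorted tot (ch v); have := mem_sort (relpre weight leq) (ch v).
case: sort => //= a s M so _; split; first by rewrite -M mem_head.
move=> c; rewrite -M inE => /orP[/eqP->//|cs].
exact: (allP (order_path_min tr so)).
Qed.

Lemma lightest_child v : lightest v \in ch v.
Proof. by case: (lightestP v). Qed.

Lemma weight_anc u v : anc u v -> weight v <= weight u.
Proof.
move=> uv; apply: sub_count => x /holdsP vx; apply/holdsP.
exact: anc_trans uv vx.
Qed.

(** A second child weighs at least as much as the lightest one, and the two have no common
    descendant. *)
Lemma weight_branching v : 1 < size (ch v) -> (weight (lightest v)).*2 <= weight v.
Proof.
have [lv min] := lightestP v => s1.
have [c cv nc] : exists2 c, c \in ch v & c != lightest v.
  case: (ch v) (uniq_children v) s1 => [|a [|b s]] //= /andP[+ _] _.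
  rewrite inE negb_or => /andP[ab _].
  case: (a =P lightest v) => [<-|/eqP na]; last by exists a; rewrite ?mem_head.
  by exists b; rewrite ?inE ?eqxx ?orbT // eq_sym.
rewrite -addnn; apply: leq_trans (leq_add (leqnn _) (min c cv)) _.
rewrite /weight -count_predUI (@eq_count _ (predI _ _) pred0) ?count_pred0 ?addn0.
  apply: sub_count => x /orP[] /holdsP H; apply/holdsP.
    exact: anc_trans (anc_child lv) H.
  exact: anc_trans (anc_child cv) H.
move=> x /=; apply/negP => /andP[/holdsP lx /holdsP cx].
by case/eqP: nc; apply: siblings_disjoint cv lv cx lx.
Qed.

Definition spine v x := exists k, x = iter k lightest v.

Lemma spine_refl v : spine v v. Proof. by exists 0. Qed.

Lemma spine_lightest v x : spine (lightest v) x -> spine v x.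
Proof. by case=> k ->; exists k.+1; rewrite iterSr. Qed.

Lemma anc_iter v k : anc v (iter k lightest v).
Proof.
elim: k => [|k IH]; first exact: anc_refl.
exact: anc_step IH (lightest_child _).
Qed.

(** A repetition would make a node and its child ancestors of each other, although they lie in
    different layers. *)
Lemma uniq_spine v n : uniq (traject lightest v n).
Proof.
elim: n v => //= n IH v; rewrite IH andbT.
apply/trajectP => -[i _ E].
have a1 := anc_child (lightest_child v).
have a2 := anc_iter (lightest v) i; rewrite -E in a2.
have [m vm] := in_layer v.
have := layer_inj (child_layer (lightest_child v) vm).
by rewrite -(anc_antisym a1 a2) => /(_ m vm); lia.
Qed.

Lemma chain_spine v n : chainP (tadj ch) v (traject lightest (lightest v) n).
Proof.
elim: n v => //= n IH v; split=> //; left; exact: lightest_child.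
Qed.

Variable B : nat.
Hypothesis short_paths : forall x s, uniq (x :: s) -> chainP (tadj ch) x s ->
  all (fun v => tdeg r ch v == 2) (x :: s) -> size s <= B.

Lemma weight_iter v n m :
  n <= m -> weight (iter m lightest v) <= weight (iter n lightest v).
Proof.
by move=> /subnK <-; rewrite iterD; apply: weight_anc; apply: anc_iter.
Qed.

(** The [B.+2] spine nodes after [v] form a path too long for all of them to have degree 2. None of
    them is the root, so one whose degree is not 2 has at least two children, and the weight halves
    at the next step, which is at most the [B.+3]-rd. *)
Lemma weight_halved v : (weight (iter B.+3 lightest v)).*2 <= weight v.
Proof.
have [|/allPn[x /trajectP[i iB ->]]] :=
    boolP (all (fun v => tdeg r ch v == 2) (traject lightest (lightest v) B.+2)).
  move/(short_paths (s := traject lightest _ B.+1) (uniq_spine _ B.+2)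
          (chain_spine _ B.+1)).
  by rewrite size_traject ltnn.
rewrite -iterSr /tdeg.
have -> : iter i.+1 lightest v != r.
  by apply: contraTneq (lightest_child (iter i lightest v)) => /= ->; exact: root_not_child.
have := no_leaf (iter i.+1 lightest v) => s1; rewrite addn1 eqSS => s2.
apply: leq_trans (weight_iter v (leq0n i.+1)).
apply: leq_trans (weight_branching _); last by rewrite ltn_neqAle eq_sym s2.
by rewrite leq_double -iterS; apply: weight_iter.
Qed.

(** The spine of [v] is its first [B.+3] nodes followed by the spine of [w], whose weight is at most
    half; this lowers [k] by one. *)
Lemma spine_bound : uniq S -> forall k v, weight v < 2 ^ k ->
  count (fun x => holds (spine v x)) S <= k * B.+3.
Proof.
move=> uS; elim=> [|k IH] v wv.
  have : weight v <= 0 by [].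
  apply: leq_trans; apply: sub_count => x /holdsP[i ->].
  by apply/holdsP; apply: anc_iter.
set w := iter B.+3 lightest v.
rewrite mulSn -size_filter.
apply: (@leq_trans (size (traject lightest v B.+3 ++
                     [seq x <- S | holds (spine w x)]))); last first.
  rewrite size_cat size_traject leq_add2l size_filter IH //.
  by have := weight_halved v; rewrite -/w; move: wv; rewrite expnS; lia.
apply: uniq_leq_size; first exact: filter_uniq.
move=> x; rewrite mem_filter mem_cat => /andP[/holdsP[i Ei] xS].
case: (ltnP i B.+3) => iB; first by apply/orP; left; apply/trajectP; exists i.
apply/orP; right; rewrite mem_filter xS andbT; apply/holdsP.
by exists (i - B.+3); rewrite Ei /w -iterD subnK.
Qed.

(* [w] is the topmost node whose spine contains [x]. *)
Definition owner x w := spine w x /\ forall u, w <> lightest u.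

Lemma lightest_inj : injective lightest.
Proof.
move=> u v E; have uu := lightest_child u.
by apply: parent_inj uu _; rewrite E; apply: lightest_child.
Qed.

(** As [lightest] is injective, the two spines can be traced back from [x] in parallel. If one
    stopped earlier, its top would be a lightest child. *)
Lemma owner_inj x v w : owner x v -> owner x w -> v = w.
Proof.
move=> [[i Ei] nv] [[j Ej] nw]; rewrite Ei {Ei} in Ej.
elim: i j Ej => [|i IH] [|j] //=.
- by move/nv.
- by move/esym/nw.
- by move/lightest_inj/IH.
Qed.

(** * Gaps between consecutive spines *)

Definition ltch v := take (index (lightest v) (ch v)) (ch v).
Definition rtch v := drop (index (lightest v) (ch v)).+1 (ch v).

Lemma children_split v : ch v = ltch v ++ lightest v :: rtch v.
Proof. by rewrite /rtch -drop_index ?lightest_child // cat_take_drop. Qed.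

Lemma mem_children_split c v :
  (c \in ch v) = [|| c \in ltch v, c == lightest v | c \in rtch v].
Proof. by rewrite [in LHS]children_split mem_cat inE. Qed.

Lemma lt_rt_disjoint c v : c \in ltch v -> c \in lightest v :: rtch v -> False.
Proof.
have := uniq_children v; rewrite children_split cat_uniq => /and3P[_ /hasPn H _].
by move=> cl /H /negP.
Qed.

(* Each layer is closed up into a cycle, so that there is also a gap between its
   last and its first node; below the gap [p] lie the children of [p.1] right of
   its spine and the children of [p.2] left of its spine. *)
Definition row (p : nat * nat) :=
  (lightest p.1 :: rtch p.1) ++ rcons (ltch p.2) (lightest p.2).

Definition split_gap p := adjacent_pairs (row p).

Lemma split_gap1 p :
  unzip1 (split_gap p) = (lightest p.1 :: rtch p.1) ++ ltch p.2.
Proof. by rewrite /split_gap /row -rcons_cat unzip1_adjacent. Qed.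

Lemma split_gap2 p :
  unzip2 (split_gap p) = rtch p.1 ++ rcons (ltch p.2) (lightest p.2).
Proof. by rewrite unzip2_adjacent. Qed.

Lemma mem_split_gap p q :
  p \in split_gap q -> (p.1 \in (lightest q.1 :: rtch q.1) ++ ltch q.2) /\
  (p.2 \in rtch q.1 ++ rcons (ltch q.2) (lightest q.2)).
Proof. by move=> pq; rewrite -split_gap1 -split_gap2 !map_f. Qed.

(** Closed up into a cycle, the root layer has a single gap, from [r] to itself. *)
Fixpoint gaps n :=
  if n is n'.+1 then flatten (map split_gap (gaps n')) else [:: (r, r)].

Lemma gaps_layer n p : p \in gaps n -> p.1 \in layer n /\ p.2 \in layer n.
Proof.
elim: n p => [|n IH] p; first by rewrite inE => /eqP ->; rewrite !mem_head.
move=> /flatten_mapP[q /IH[q1 q2] /mem_split_gap[]].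
rewrite !mem_cat mem_rcons !inE => H1 H2.
by split; [case: (orP H1) | case: (orP H2)] => H;
  [ apply: (child_layer (u := q.1)) | apply: (child_layer (u := q.2))
  | apply: (child_layer (u := q.1)) | apply: (child_layer (u := q.2))] => //;
  rewrite mem_children_split; move: H; [case/orP | | | case/orP] => ->;
  rewrite ?orbT.
Qed.

(** Among left ends, the lightest child of [v] and those to its right occur only below the gap
    starting at [v], and those to its left only below the gap ending at [v]. Both gaps are unique by
    induction. Among right ends the lightest child changes sides. *)
Lemma gaps_uniq n : uniq (unzip1 (gaps n)) /\ uniq (unzip2 (gaps n)).
Proof.
elim: n => [|n [u1 u2]] //=.
have inj1 p q : p \in gaps n -> q \in gaps n -> p.1 = q.1 -> p = q.
  exact: uniq_map_inj u1.
have inj2 p q : p \in gaps n -> q \in gaps n -> p.2 = q.2 -> p = q.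
  exact: uniq_map_inj u2.
have uL v : uniq (ltch v) by apply: take_uniq (uniq_children v).
have uR v : uniq (lightest v :: rtch v).
  by move: (uniq_children v); rewrite children_split cat_uniq => /and3P[].
have cL c v : c \in ltch v -> c \in ch v.
  by rewrite mem_children_split => ->.
have cR c v : c \in lightest v :: rtch v -> c \in ch v.
  by rewrite mem_children_split inE => ->; rewrite orbT.
have cR' c v : c \in rtch v -> c \in lightest v :: rtch v.
  by rewrite inE orbC => ->.
have LR c v w : c \in ltch v -> c \in lightest w :: rtch w -> False.
  move=> cl cr; have E := parent_inj (cL _ _ cl) (cR _ _ cr).
  by apply: lt_rt_disjoint cl _; rewrite E.
have lL v w : lightest v \in ltch w -> False.
  by move/(@LR _ _ v); apply; rewrite mem_head.
have cl' c v : c \in rcons (ltch v) (lightest v) -> c \in ch v.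
  by rewrite mem_rcons inE mem_children_split => /orP[]->; rewrite ?orbT.
have LR' c v w : c \in rcons (ltch v) (lightest v) -> c \in rtch w -> False.
  rewrite mem_rcons inE => /orP[/eqP E cr|cl cr]; last exact: LR cl (cR' _ _ cr).
  have Ew : v = w.
    by apply: parent_inj (lightest_child v) _; rewrite -E cR ?cR'.
  by have := uR w; rewrite /= -Ew -E Ew cr.
rewrite /unzip1 /unzip2 !map_flatten -!map_comp.
rewrite (eq_map (g := fun p => (lightest p.1 :: rtch p.1) ++ ltch p.2));
  last by move=> p /=; apply: split_gap1.
rewrite (eq_map (f := map snd \o split_gap)
   (g := fun p => rtch p.1 ++ rcons (ltch p.2) (lightest p.2)));
  last by move=> p /=; apply: split_gap2.
split; apply: uniq_flatten_map; try exact: map_uniq u1.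
- move=> p _; rewrite cat_uniq uR uL andbT /=; apply/hasPn => c cl.
  by apply/negP; apply: LR cl.
- move=> p q c pn qn; rewrite !mem_cat => /orP[cp|cp] /orP[cq|cq].
  + by apply: inj1 => //; apply: parent_inj (cR _ _ cp) (cR _ _ cq).
  + by case: (LR _ _ _ cq cp).
  + by case: (LR _ _ _ cp cq).
  + by apply: inj2 => //; apply: parent_inj (cL _ _ cp) (cL _ _ cq).
- move=> p _; rewrite cat_uniq rcons_uniq uL andbT.
  have /= /andP[_ ->] := uR p.1; rewrite andTb; apply/andP; split.
    by apply/hasPn => c cl; apply/negP; apply: LR' cl.
  by apply/negP; apply: lL.
- move=> p q c pn qn; rewrite !mem_cat => /orP[cp|cp] /orP[cq|cq].
  + by apply: inj1 => //; apply: parent_inj (cR _ _ (cR' _ _ cp)) (cR _ _ (cR' _ _ cq)).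
  + by case: (LR' _ _ _ cq cp).
  + by case: (LR' _ _ _ cp cq).
  + by apply: inj2 => //; apply: parent_inj (cl' _ _ cp) (cl' _ _ cq).
Qed.

Lemma gaps_cover n v : v \in layer n -> v \in unzip1 (gaps n) /\ v \in unzip2 (gaps n).
Proof.
elim: n v => [|n IH] v; first by rewrite inE => /eqP->; rewrite eqxx.
move=> /mem_layerS[u /IH[/mapP[p pn Ep] /mapP[q qn Eq]] vu].
rewrite /unzip1 /unzip2 !map_flatten -!map_comp.
have go1 a : a \in gaps n -> v \in (lightest a.1 :: rtch a.1) ++ ltch a.2 ->
    v \in flatten (map (map fst \o split_gap) (gaps n)).
  by move=> an va; apply/flatten_mapP; exists a => //=; rewrite [map _ _]split_gap1.
have go2 a : a \in gaps n -> v \in rtch a.1 ++ rcons (ltch a.2) (lightest a.2) ->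
    v \in flatten (map (map snd \o split_gap) (gaps n)).
  by move=> an va; apply/flatten_mapP; exists a => //=; rewrite [map _ _]split_gap2.
move: vu; rewrite mem_children_split => /or3P[H|H|H]; split.
- by apply: (go1 q) => //; rewrite mem_cat -Eq H orbT.
- by apply: (go2 q) => //; rewrite mem_cat -Eq mem_rcons inE H !orbT.
- by apply: (go1 p) => //; rewrite mem_cat -Ep inE H.
- by apply: (go2 q) => //; rewrite mem_cat -Eq mem_rcons inE H !orbT.
- by apply: (go1 p) => //; rewrite mem_cat -Ep inE H orbT.
- by apply: (go2 p) => //; rewrite mem_cat -Ep H.
Qed.

Lemma infix_gaps n x y : infix [:: x; y] (layer n) -> (x, y) \in gaps n.
Proof.
elim: n x y => [|n IH] x y; first by rewrite /= andbF.
have nonempty v : ch v != [::] by rewrite -size_eq0 -lt0n.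
case/(infix2_flatten nonempty) => [[u un]|[u [v [s [t [uv Eu Ev]]]]]].
  have [/mapP[p pn Ep] /mapP[q qn Eq]] := gaps_cover un.
  (* Siblings up to the lightest child share the row of the gap [q] ending at [u]; siblings from the
     lightest child on share the row of the gap [p] starting at [u]. *)
  rewrite children_split -cat_rcons => /infix2_cat[H|H|].
  - apply/flatten_mapP; exists q => //; apply: mem_adjacent_pairs.
    by rewrite /row -Eq infix_catl.
  - apply/flatten_mapP; exists p => //; apply: mem_adjacent_pairs.
    by rewrite /row -Ep infix_catr //= H orbT.
  - move=> [s [t [/rcons_inj[_ Ex] Et]]].
    apply/flatten_mapP; exists p => //; apply: mem_adjacent_pairs.
    by rewrite /row -Ep Et -Ex /= !eqxx prefix0s.
(* Here [x] is the last child of [u] and [y] the first child of [v]; they meet where the two halves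
   of the row of [(u, v)] join. *)
apply/flatten_mapP; exists (u, v); first exact: IH.
apply: mem_adjacent_pairs.
rewrite (_ : row _ = (lightest u :: rtch u) ++ rcons (ltch v) (lightest v)) //.
have -> : x = last (lightest u) (rtch u).
  by have := congr1 (last 0) Eu; rewrite last_rcons children_split last_cat.
have [w ->] : exists w, rcons (ltch v) (lightest v) = y :: w.
  have := Ev; rewrite children_split; case: (ltch v) => [|a l] /= [<- _].
    by exists [::].
  by exists (rcons l (lightest v)).
by rewrite (lastI (lightest u)) cat_rcons; apply/infixP; exists (belast (lightest u) (rtch u)), w.
Qed.

(** * Boundaries and bags *)

Variable E : nat -> nat -> Prop.

Definition attaches_above v x := [/\ anc x v, x <> v & exists2 y, anc v y & E x y].

Definition boundary v := [seq x <- S | holds (spine v x \/ attaches_above v x)].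

Lemma mem_boundary v x :
  x \in boundary v <-> x \in S /\ (spine v x \/ attaches_above v x).
Proof.
by rewrite mem_filter; split=> [/andP[/holdsP]|[xS /holdsP->]].
Qed.

Lemma boundary_self v : v \in S -> v \in boundary v.
Proof. by move=> vS; apply/mem_boundary; split=> //; left; apply: spine_refl. Qed.

(** An edge ending below [v] also ends below its parent [u], so an ancestor attached above [v] is
    either attached above [u] or is [u], which lies on its own spine. *)
Lemma boundary_child u v x :
  v \in ch u -> x \in boundary v -> spine v x \/ x \in boundary u.
Proof.
move=> vu /mem_boundary[xS [|[xv nxv [y vy xy]]]]; first by left.
right; apply/mem_boundary; split=> //.
case: (anc_parent xv vu) => // xu.
case: (x =P u) => [->|nxu]; first by left; apply: spine_refl.
by right; split=> //; exists y => //; apply: anc_trans (anc_child vu) vy.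
Qed.

Lemma boundary_lightest v : {subset boundary (lightest v) <= boundary v}.
Proof.
move=> x xl; case: (boundary_child (lightest_child v) xl) => // sx.
move/mem_boundary: xl => [xS _]; apply/mem_boundary; split=> //.
by left; apply: spine_lightest.
Qed.

(** Without proper ancestors, the root contributes only its spine, of which it is the top. *)
Lemma boundary_root x : x \in boundary r -> owner x r.
Proof.
move=> /mem_boundary[_ [sx|[xr nxr _]]].
  by split=> // u Er; have := lightest_child u; rewrite -Er; apply/negP/root_not_child.
have top v : anc x v -> v = r -> x = r.
  by case=> // w u _ uw Eu; case/negP: (root_not_child w); rewrite -Eu.
by case: nxr; apply: top xr _.
Qed.

(** A child that is not the lightest starts a new spine, and only this spine can add vertices to the
    boundary of [u]. *)
Lemma boundary_other_child u v x :
  v \in ch u -> v != lightest u -> x \in boundary v ->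
  x \in boundary u \/ owner x v.
Proof.
move=> vu nv xv; case: (boundary_child vu xv); last by left.
move=> sx; right; split=> // w Ew; case/eqP: nv.
by rewrite (parent_inj vu (u' := w)) // Ew lightest_child.
Qed.

(* A slot is a gap of a layer together with the gap of the previous layer it lies below. *)
Definition slot : eqType := ((nat * nat) * (nat * nat))%type.

Definition bag (s : slot) :=
  boundary s.1.1 ++ boundary s.1.2 ++ boundary s.2.1 ++ boundary s.2.2.

(** With each gap attached to the one on its left, only the right end can bring new vertices. *)
Definition key (s : slot) := s.2.2.

Definition slots_below (s : slot) : seq slot := [seq (s.2, p) | p <- split_gap s.2].

(** The root gap has no gap above it and takes itself in that place. *)
Fixpoint slots n : seq slot :=
  if n is n'.+1 then flatten (map slots_below (slots n')) else [:: ((r, r), (r, r))].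

Definition slots_upto N := flatten [seq slots n | n <- iota 0 N.+1].

Lemma slots_gaps n : map snd (slots n) = gaps n.
Proof.
elim: n => //= n <-; rewrite map_flatten -!map_comp; congr flatten.
apply: eq_map => s /=; rewrite /slots_below -map_comp.
by rewrite (eq_map (g := id)) ?map_id.
Qed.

Lemma slots_uptoS N : slots_upto N.+1 = slots_upto N ++ slots N.+1.
Proof.
by rewrite /slots_upto -(addn1 N.+1) iotaD map_cat flatten_cat /= cats0.
Qed.

(** * Attaching the slots row by row *)

(** The row below the gap [g] is scanned from left to right: [x] is the node reached, [w] lists the
    nodes still to come, and [s0] is the slot to which the next one is attached. *)
Lemma attached_chain g w x l s0 : attached key bag owner l -> s0 \in l ->
  {subset boundary g.1 ++ boundary g.2 ++ boundary x <= bag s0} ->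
  (forall y z, y \in w -> z \in boundary y ->
     z \in boundary g.1 ++ boundary g.2 \/ owner z y) ->
  attached key bag owner (l ++ [seq (g, p) | p <- adjacent_pairs (x :: w)]).
Proof.
elim: w x l s0 => [|y w IH] x l s0 al s0l sub Hw; first by rewrite /= cats0.
rewrite (_ : map _ _ = (g, (x, y)) :: [seq (g, p) | p <- adjacent_pairs (y :: w)]) //.
rewrite -cat_rcons; apply: (IH _ _ (g, (x, y))).
- apply: attached_rcons al s0l _ => z.
  rewrite {1}/bag /= catA [z \in _ ++ _]mem_cat mem_cat [z \in boundary x ++ _]mem_cat.
  case/or3P.
  + by move=> /orP[] zg; left; apply: sub; rewrite !mem_cat zg ?orbT.
  + by move=> zx; left; apply: sub; rewrite !mem_cat zx !orbT.
  + move=> zy; case: (Hw y z _ zy); rewrite ?mem_head //; last by right.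
    by rewrite mem_cat => /orP[] zg; left; apply: sub; rewrite !mem_cat zg ?orbT.
- by rewrite mem_rcons mem_head.
- by move=> z; rewrite /bag /= !mem_cat => /or3P[] ->; rewrite ?orbT.
- by move=> a z aw; apply: Hw; rewrite inE aw orbT.
Qed.

(** The scan can start at [s] itself, because the row begins with the lightest child of [s.2.1],
    whose boundary shrinks. The last node, the lightest child of [s.2.2], adds nothing for the same
    reason, and each node in between owns what it adds. *)
Lemma attached_slots_below l s : attached key bag owner l -> s \in l ->
  attached key bag owner (l ++ slots_below s).
Proof.
move=> al sl; apply: (attached_chain (s0 := s)) => //.
  move=> z; rewrite /bag !mem_cat => /or3P[zb|zb|/boundary_lightest zb];
  by rewrite zb !orbT.
move=> y z; rewrite mem_cat mem_rcons inE => yw zy.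
have other v : y \in ch v -> y != lightest v -> (v = s.2.1 \/ v = s.2.2) ->
    z \in boundary s.2.1 ++ boundary s.2.2 \/ owner z y.
  move=> yv nv Ev; case: (boundary_other_child yv nv zy); last by right.
  by left; rewrite mem_cat; case: Ev => <-; apply/orP; [left|right].
case/or3P: yw => [yr|/eqP Ey|yl].
- apply: (other s.2.1); [by rewrite mem_children_split yr !orbT | | by left].
  have := uniq_children s.2.1; rewrite children_split cat_uniq cons_uniq.
  by move=> /and3P[_ _ /andP[nl _]]; apply: contraNneq nl => <-.
- left; rewrite mem_cat; apply/orP; right.
  by apply: boundary_lightest; rewrite -Ey.
- apply: (other s.2.2); [by rewrite mem_children_split yl | | by right].
  by apply/eqP => Ey; apply: (lt_rt_disjoint yl); rewrite Ey mem_head.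
Qed.

Lemma attached_slots N : attached key bag owner (slots_upto N).
Proof.
elim: N => [|N IH].
  apply: attached1 => x; rewrite /bag !mem_cat /key /=.
  by case/or4P; apply: boundary_root.
rewrite slots_uptoS [slots N.+1]/=.
have : {subset slots N <= slots_upto N}.
  move=> s sN; apply/flatten_mapP; exists N => //.
  by rewrite mem_iota ltnSn.
(* The list built so far is generalised to [l], so that the slots of layer [N] can be extended
   downwards one at a time. *)
elim: (slots N) (slots_upto N) IH => [|s ss IHs] l al sub /=; first by rewrite cats0.
rewrite catA; apply: IHs.
  by apply: attached_slots_below => //; apply: sub; rewrite mem_head.
by move=> a ass; rewrite mem_cat sub // inE ass orbT.
Qed.

(** Keys are right ends of gaps: distinct within a layer by [gaps_uniq], and across layers because
    layers are disjoint. *)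
Lemma uniq_keys N : uniq (map key (slots_upto N)).
Proof.
rewrite map_flatten -map_comp.
have Ekey n : (map key \o slots) n = unzip2 (gaps n).
  by rewrite /= -slots_gaps /unzip2 -map_comp.
have lay n x : x \in (map key \o slots) n -> x \in layer n.
  by rewrite Ekey => /mapP[p /gaps_layer[_ H] ->].
apply: uniq_flatten_map; first exact: iota_uniq.
- by move=> n _; rewrite Ekey; case: (gaps_uniq n).
- by move=> n m x _ _ /lay xn /lay xm; apply: layer_inj xn xm.
Qed.

Lemma slot_of_gap n N p : n <= N -> p \in gaps n ->
  exists2 s, s \in slots_upto N & s.2 = p.
Proof.
move=> nN; rewrite -slots_gaps => /mapP[s sn ->]; exists s => //.
by apply/flatten_mapP; exists n => //; rewrite mem_iota.
Qed.

Lemma slot_of_vertex n N v : n <= N -> v \in layer n ->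
  exists2 s, s \in slots_upto N & s.2.1 = v.
Proof.
move=> nN /gaps_cover[/mapP[p pn ->] _].
by have [s sN <-] := slot_of_gap nN pn; exists s.
Qed.

(** * Boundary sizes and the treewidth of the wheel *)

Variable t : nat.
Hypotheses (uS : uniq S) (symE : forall x y, E x y -> E y x).
Hypothesis irrE : forall x, ~ E x x.
Hypothesis layerE : forall n x y, x \in layer n -> y \in layer n ->
  (E x y <-> consecutive (layer n) x y).
Hypothesis crossE : forall x y, E x y -> ~ same_layer r ch x y ->
  anc x y \/ anc y x.
Hypothesis upE : forall v, exists X : seq nat, [/\ size X <= t,
  (forall u, u \in X -> anc u v) &
  (forall x y, E x y -> ~ same_layer r ch x y -> anc v x -> ~ anc v y -> y \in X)].

(** The spine part is bounded by [spine_bound]. Every other vertex is a proper ancestor joined to a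
    descendant of [v], hence belongs to the set [X] of [upE]. *)
Lemma boundary_size k v : size S < 2 ^ k -> size (boundary v) <= k * B.+3 + t.
Proof.
move=> Sk; rewrite size_filter.
have wk : weight v < 2 ^ k by apply: leq_ltn_trans Sk; apply: count_size.
apply: leq_trans (leq_add (spine_bound uS wk) (leqnn t)).
apply: (@leq_trans (count (fun x => holds (spine v x)) S +
                    count (fun x => holds (attaches_above v x)) S)).
  rewrite -count_predUI; apply: leq_trans (leq_addr _ _).
  apply: sub_count => x /holdsP[] /holdsP H; apply/orP; by [left|right].
rewrite leq_add2l -size_filter; have [X [szX _ HX]] := upE v.
apply: leq_trans szX; apply: uniq_leq_size; first exact: filter_uniq.
move=> x; rewrite mem_filter => /andP[/holdsP[xv nxv [y vy xy]] _].
have nvx : ~ anc v x by move=> vx; apply/nxv/anc_antisym.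
apply: (HX y x) => //; first exact: symE.
(* The edge is not inside a layer: [x] is an ancestor of [y], so a common layer would force
   [x = y]. *)
move=> [n [yn xn]]; apply: nvx.
by rewrite (anc_layer_eq (anc_trans xv vy) xn yn).
Qed.

Lemma wheel_treewidth k : size S < 2 ^ k -> treewidth_le E S (4 * (k * B.+3 + t)).
Proof.
move=> Sk.
(* Only finitely many layers meet [S]; the slots down to the last of them suffice. *)
have [N HN] : exists N, forall x, x \in S -> exists2 n, n <= N & x \in layer n.
  elim: (S) => [|a s [N HN]]; first by exists 0.
  have [n an] := in_layer a; exists (maxn n N) => x; rewrite inE => /orP[/eqP->|/HN].
    by exists n; rewrite ?leq_maxl.
  by case=> m mN xm; exists m => //; rewrite (leq_trans mN) ?leq_maxr.
apply: (attached_decomposition (@owner_inj) (attached_slots N) (uniq_keys N)).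
- by move=> s _ x; rewrite /bag !mem_cat => /or4P[] /mem_boundary[].
- move=> x xS; have [n nN xn] := HN x xS.
  have [s sN Es] := slot_of_vertex nN xn.
  by exists s => //; rewrite /bag !mem_cat Es boundary_self ?orbT.
- move=> x y xS yS Exy.
  have cover a b : a \in S -> b \in S -> E a b -> anc a b ->
      exists s, [/\ s \in slots_upto N, a \in bag s & b \in bag s].
    (* The ancestor [a] is attached above [b], with [b] as its neighbour, so any slot with end [b]
       contains both. *)
    move=> aS bS Eab ab; have [n nN bn] := HN b bS.
    have [s sN Es] := slot_of_vertex nN bn.
    exists s; split=> //; rewrite /bag !mem_cat Es ?(boundary_self bS) ?orbT //.
    suff -> : a \in boundary b by rewrite !orbT.
    apply/mem_boundary; split=> //; right; split=> //.
      by move=> Eq; apply: (irrE (x := a)); rewrite {2}Eq.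
    by exists b => //; apply: anc_refl.
  have gap n a b : n <= N -> a \in S -> b \in S -> infix [:: a; b] (layer n) ->
      exists s, [/\ s \in slots_upto N, a \in bag s & b \in bag s].
    move=> nN aS bS /infix_gaps /(slot_of_gap nN)[s sN Es]; exists s.
    by split=> //; rewrite /bag !mem_cat Es ?(boundary_self aS) ?(boundary_self bS) !orbT.
  case: (excluded_middle_informative (same_layer r ch x y)) => [|nl].
    move=> [n [xn yn]]; have [m mN xm] := HN x xS.
    have nN : n <= N by rewrite (layer_inj xn xm).
    case: (consecutive_infix ((layerE xn yn).1 Exy)) => [|/gap]; first exact: gap.
    by case/(_ nN yS xS) => s [? ? ?]; exists s.
  case: (crossE Exy nl) => [|/cover]; first exact: cover.
  by case/(_ yS xS (symE Exy)) => s [? ? ?]; exists s.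
(* A bag consists of four boundaries, whence the factor 4. *)
- move=> s _; have sz v := boundary_size v Sk.
  rewrite /bag !size_cat; apply: leqW; rewrite !mulSn mul0n addn0.
  by rewrite !leq_add.
Qed.

End Descent.
End RootedTree.

(** * From binary to natural logarithms *)

Lemma log2_le_ln n k : 0 < n -> 2 ^ k <= n -> Rle (Rmult (INR k) (ln 2)) (ln (INR n)).
Proof.
move=> n0 kn; rewrite -ln_pow; last lra.
have pow_gt0 : Rlt 0 (pow 2 k) by apply: pow_lt; lra.
have le_pow : Rle (pow 2 k) (INR n).
  have -> : pow 2 k = INR (2 ^ k).
    elim: k {kn pow_gt0} => [|k IH] //=.
    by rewrite expnS mult_INR IH.
  by apply: le_INR; apply/leP.
case: (Rle_lt_or_eq_dec _ _ le_pow) => [lt|->]; last exact: Rle_refl.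
by apply/Rlt_le/ln_increasing.
Qed.

Theorem theorem1p13 (r : nat) (ch : nat -> seq nat) (E : nat -> nat -> Prop) :
  layered_wheel r ch E -> neat ch -> upward_restricted r ch E ->
  exists c : R, forall S : seq nat, uniq S -> 2 <= size S ->
    exists k : nat, treewidth_le E S k /\ Rle (INR k) (Rmult c (ln (INR (size S)))).
Proof.
move=> [tree [symE irrE] layerE crossE [B short]] no_leaf [t upE].
(* Let [l] be the integer part of the binary logarithm of [size S]. As [size S] is at least 2, [l]
   is at least 1, so [l.+1 * B.+3 + t] is at most [(2 * B.+3 + t) * l]; dividing by [ln 2] changes
   the base. *)
exists (Rdiv (INR (4 * (2 * B.+3 + t))) (ln 2)) => S uS S2.
have S0 : 0 < size S by apply: ltn_trans S2.
have Slog : size S < 2 ^ (trunc_log 2 (size S)).+1 by apply: trunc_log_ltn.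
have log1 : 0 < trunc_log 2 (size S) by rewrite trunc_log_gt0.
have logS := trunc_logP (isT : 1 < 2) S0.
exists (4 * ((trunc_log 2 (size S)).+1 * B.+3 + t)); split.
  exact: (wheel_treewidth tree no_leaf short uS symE irrE layerE crossE upE Slog).
move: (trunc_log 2 (size S)) log1 logS => l l0 lS.
have ln2 : Rlt 0 (ln 2) by rewrite -ln_1; apply: ln_increasing; lra.
apply: (Rle_trans _ (Rmult (INR (4 * (2 * B.+3 + t))) (INR l))).
  rewrite -mult_INR; apply: le_INR; apply/leP.
  rewrite multE -mulnA leq_mul2l /= mulnDl leq_add ?leq_pmulr //.
  by rewrite mulnAC leq_mul2r; apply/orP; right; lia.
rewrite /Rdiv Rmult_assoc; apply: Rmult_le_compat_l; first exact: pos_INR.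
apply: (Rmult_le_reg_r (ln 2)) => //.
have -> : Rmult (Rmult (Rinv (ln 2)) (ln (INR (size S)))) (ln 2) = ln (INR (size S)).
  by field; lra.
exact: log2_le_ln.
Qed.
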